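(* For Matching in the Late Reject model, the competitive ratio is $2$; that is, there is a strictly $2$-competitive online algorithm in this model, and for every real $c<2$ no online algorithm in this model is $c$-competitive.
   Context: Online Matching (edge arrival). An input $\sigma$ is a finite simple undirected graph $G=(V,E)$ together with an ordering of its edges. Edges arrive one by one in this order; endpoints not seen before are revealed with the edge. All online algorithms are deterministic: each decision depends only on the part of the input revealed so far. After each arrival the algorithm maintains a set of currently accepted edges, which must be a matching (pairwise non-incident edges). $\mathrm{ALG}(\sigma)$ is the number of accepted edges at the end of the input, and $\mathrm{OPT}(\sigma)$ is the maximum cardinality of a matching in $G$; the objective is maximization. Late Reject model: upon arrival of an edge the algorithm either accepts or rejects it; in addition, in any step it may remove (late-reject) any previously accepted edges. Any rejection (at arrival or late) is irrevocable, i.e., a rejected edge can never be accepted afterwards. An algorithm $\mathrm{ALG}$ is $c$-competitive if there is a constant $\alpha$ such that $\mathrm{OPT}(\sigma)\le c\,\mathrm{ALG}(\sigma)+\alpha$ for all inputs $\sigma$; it is strictly $c$-competitive if this holds with $\alpha=0$. By convention, ''the competitive ratio is $c$'' includes that the upper bound holds for the strict competitive ratio and the lower bound for the (non-strict) competitive ratio. *)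

(* Defs.v *)
From mathcomp Require Import all_boot all_order all_algebra finmap reals.
Set Implicit Arguments. Unset Strict Implicit. Unset Printing Implicit Defensive.
Import Order.TTheory GRing.Theory Num.Theory.
Local Open Scope fset_scope.
Local Open Scope ring_scope.

Notation vertex := nat (only parsing).
Notation edge := {fset nat} (only parsing).

(** [vertices] may contain isolated vertices; these are never revealed to an
    algorithm. The edge set of the graph is the set of items of [arrivals]. *)
Record input := Input {
  vertices : {fset vertex};
  arrivals : seq edge;
  arrivals_uniq : uniq arrivals;
  arrivals_simple : forall e, e \in arrivals ->
    e `<=` vertices /\ #|` e| = 2%N }.

Definition edges (sigma : input) : {fset edge} :=
  [fset e | e in arrivals sigma].

Definition matching (M : {fset edge}) : bool :=
  [forall e : M, forall f : M,
    (val e != val f) ==> [disjoint val e & val f]%fset].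

Definition OPT (sigma : input) : nat :=
  (\max_(M <- fpowerset (edges sigma) | matching M) #|` M|)%N.

(** [accept] concerns the edge that has just arrived, [late_reject] the edges
    accepted earlier. There is no way to bring back a rejected edge. *)
Record decision := Decision { accept : bool; late_reject : {fset edge} }.

Definition update (d : decision) (e : edge) (M : {fset edge}) : {fset edge} :=
  let kept := M `\` late_reject d in
  if accept d then e |` kept else kept.

(** The decision taken on an arrival is a function of the edges revealed so far
    (in order of arrival, the current one last). Earlier decisions are determined
    by the same data, so they need not be passed to the strategy. *)
Definition strategy := seq edge -> decision.

Fixpoint run (D : strategy) (past : seq edge) (M : {fset edge})
    (future : seq edge) : {fset edge} :=
  if future is e :: future' then
    let past' := rcons past e in
    run D past' (update (D past') e M) future'
  else M.

Definition accepted (D : strategy) (s : seq edge) : {fset edge} :=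
  run D [::] fset0 s.

Record late_reject_algorithm := LateRejectAlgorithm {
  decide :> strategy;
  accepted_matching : forall (sigma : input) (k : nat),
    matching (accepted decide (take k (arrivals sigma))) }.

Definition ALG (A : late_reject_algorithm) (sigma : input) : nat :=
  #|` accepted A (arrivals sigma)|.

Definition competitive_with (R : realType) (A : late_reject_algorithm)
    (c alpha : R) : Prop :=
  forall sigma : input, (OPT sigma)%:R <= c * (ALG A sigma)%:R + alpha.

Definition competitive (R : realType) (A : late_reject_algorithm) (c : R) : Prop :=
  exists alpha : R, competitive_with A c alpha.

Definition strictly_competitive (R : realType) (A : late_reject_algorithm)
    (c : R) : Prop :=
  competitive_with A c 0.

(* Main.v *)
(** Upper bound: the greedy algorithm, which never late-rejects, keeps a maximal
    matching [M]. Every edge meets one of the at most [2 |M|] vertices covered by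
    [M], and distinct edges of a matching meet them in distinct vertices.

    Lower bound: on fresh vertices [v0 .. v4], the adversary sends [v1 v2] and
    [v2 v3]. If the algorithm holds [v1 v2], then [v2 v3] is lost and the adversary
    sends [v0 v1]; otherwise [v1 v2] is lost and it sends [v3 v4]. Either way the
    two edges the algorithm may still hold are incident, so it gains at most one
    edge, whereas the three edges form a path and OPT gains two. Repeating this
    defeats every additive constant. *)
Require Import Defs.
From mathcomp Require Import all_boot all_order all_algebra finmap reals.
From mathcomp Require Import zify lra.
Set Implicit Arguments. Unset Strict Implicit. Unset Printing Implicit Defensive.
Import Order.TTheory GRing.Theory Num.Theory.
Local Open Scope fset_scope.

(** * Matchings, and a single step of a run *)

Lemma matchingP (M : {fset {fset nat}}) :
  reflect (forall e f, e \in M -> f \in M -> e != f -> [disjoint e & f]%fset)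
          (matching M).
Proof.
apply: (iffP forallP) => [H e f eM fM nef | H e].
  by have /forallP /(_ [` fM]) /implyP /(_ nef) := H [` eM].
by apply/forallP => f; apply/implyP; apply: H; apply: valP.
Qed.

Lemma matching_fsetU1 (M : {fset {fset nat}}) (e : {fset nat}) :
  matching M -> (forall f, f \in M -> [disjoint e & f]%fset) ->
  matching (e |` M).
Proof.
move=> /matchingP mM eM; apply/matchingP => f g.
move=> /fset1UP [->|fM] /fset1UP [->|gM] nfg.
- by rewrite eqxx in nfg.
- exact: eM.
- by rewrite fdisjoint_sym eM.
- exact: mM.
Qed.

Lemma leq_OPT (sigma : input) (M : {fset {fset nat}}) :
  M `<=` edges sigma -> matching M -> (#|` M| <= OPT sigma)%N.
Proof.
by move=> sM mM; apply: leq_bigmax_seq => //; rewrite fpowersetE.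
Qed.

Lemma accepted_rcons (D : strategy) (s : seq {fset nat}) (e : {fset nat}) :
  accepted D (rcons s e) = update (D (rcons s e)) e (accepted D s).
Proof.
(* [run] consumes arrivals from the front, so the induction needs an arbitrary past and current
   set. *)
have run_rcons p M : run D p M (rcons s e)
    = update (D (rcons (p ++ s) e)) e (run D p M s).
  by elim: s p M => [|f s IHs] p M /=; rewrite ?cats0 // IHs cat_rcons.
exact: run_rcons.
Qed.

(** Irrevocability in the form used against an algorithm: an edge absent now can only be held later
    by arriving anew. *)
Lemma accepted_rcons_sub (D : strategy) (s : seq {fset nat}) (e : {fset nat}) :
  accepted D (rcons s e) `<=` e |` accepted D s.
Proof.
rewrite accepted_rcons /update; case: ifP => _.
  exact: fsetUS (fsubsetDl _ _).
exact: fsubset_trans (fsubsetDl _ _) (fsubsetUr _ _).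
Qed.

(** * The greedy algorithm and the upper bound *)

Definition greedy_step (M : {fset {fset nat}}) (e : {fset nat}) :=
  if [forall f : M, [disjoint e & val f]%fset] then e |` M else M.

Definition greedy (s : seq {fset nat}) : {fset {fset nat}} :=
  foldl greedy_step fset0 s.

(** A strategy sees the revealed edges but not the current matching, so greedy is replayed on the
    whole prefix. *)
Definition greedy_strategy : strategy :=
  fun s => Decision (last fset0 s \in greedy s) fset0.

Lemma accepted_greedy (s : seq {fset nat}) :
  accepted greedy_strategy s = greedy s.
Proof.
elim/last_ind: s => // s e IHs; rewrite accepted_rcons IHs /update /=.
rewrite last_rcons fsetD0 /greedy foldl_rcons -/(greedy s) /greedy_step.
case: [forall f : _, _]; first by rewrite fset1U1.
(* Here [greedy_step] refuses [e]; the strategy can still accept it if [e] is already in [greedy s],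
   and then adding it changes nothing. *)
by case: ifP => // /mem_fset1U.
Qed.

Lemma greedy_matching (s : seq {fset nat}) : matching (greedy s).
Proof.
elim/last_ind: s => [|s e IHs].
  by apply/matchingP => e f; rewrite in_fset0.
rewrite /greedy foldl_rcons -/(greedy s) /greedy_step.
case: ifP => // /forallP dis; apply: matching_fsetU1 => // f fM.
exact: (dis [` fM]).
Qed.

Lemma greedy_sub (s : seq {fset nat}) : {subset greedy s <= s}.
Proof.
elim/last_ind: s => [|s e IHs] f; first by rewrite in_fset0.
rewrite /greedy foldl_rcons -/(greedy s) /greedy_step mem_rcons in_cons.
case: ifP => _; last by move/IHs => ->; rewrite orbT.
by case/fset1UP => [->|/IHs ->]; rewrite ?eqxx ?orbT.
Qed.

(** A kept edge meets itself, being nonempty; a refused edge meets a blocking edge, which stays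
    because greedy never drops anything. *)
Lemma greedy_maximal (s : seq {fset nat}) (e : {fset nat}) :
  e \in s -> e != fset0 ->
  exists2 f, f \in greedy s & ~~ [disjoint e & f]%fset.
Proof.
move=> + e0; elim/last_ind: s => // s g IHs.
rewrite mem_rcons in_cons /greedy foldl_rcons -/(greedy s) /greedy_step.
case/predU1P => [<-|/IHs [f fM ef]]; last first.
  by exists f => //; case: ifP => // _; rewrite in_fset1U fM orbT.
case: ifP => [_|/negbT /forallPn [f ef]]; last by exists (val f) => //; apply: valP.
by exists e; rewrite ?fset1U1 // /fdisjoint fsetIid.
Qed.

Lemma card_bigfcup_le (I : choiceType) (T : choiceType) (s : seq I)
    (F : I -> {fset T}) (k : nat) :
  (forall i, i \in s -> #|` F i| <= k)%N ->
  (#|` \bigcup_(i <- s) F i| <= k * size s)%N.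
Proof.
elim: s => [|i s IHs] H; first by rewrite big_nil cardfs0.
rewrite big_cons /= mulnS (leq_trans (leq_card_fsetU _ _)) // leq_add //.
  by rewrite H ?mem_head.
by apply: IHs => j js; rewrite H // in_cons js orbT.
Qed.

(** Picking a vertex of [V] in each edge of [M] is injective, since distinct edges of [M] share no
    vertex. *)
Lemma card_matching_cover (M : {fset {fset nat}}) (V : {fset nat}) :
  matching M -> (forall e, e \in M -> ~~ [disjoint e & V]%fset) ->
  (#|` M| <= #|` V|)%N.
Proof.
move=> /matchingP mM MV.
pose h (e : {fset nat}) := head 0%N (enum_fset (e `&` V)).
have hP e : e \in M -> h e \in e `&` V.
  move=> /MV; rewrite /fdisjoint -cardfs_eq0 /h.
  rewrite -[_ \in _]/(_ \in enum_fset _).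
  by case: (enum_fset _) => //= x l _; rewrite mem_head.
have injh : {in M &, injective h}.
  move=> e f eM fM hef; apply/eqP; apply: contraT => nef.
  have /fdisjointP /(_ (h e)) := mM _ _ eM fM nef.
  have /fsetIP [-> _] := hP _ eM.
  by rewrite hef; have /fsetIP [-> _] := hP _ fM => /(_ isT).
rewrite -(card_in_imfset imfset_key injh); apply: fsubset_leq_card.
by apply/fsubsetP => x /imfsetP [e /hP /fsetIP [_ eV] ->].
Qed.

Lemma OPT_le_greedy (sigma : input) :
  (OPT sigma <= 2 * #|` greedy (arrivals sigma)|)%N.
Proof.
apply/bigmax_leqP_seq => M; rewrite fpowersetE => /fsubsetP sM mM.
set G := greedy _.
have card2 e : e \in arrivals sigma -> #|` e| = 2.
  by case/arrivals_simple.
apply: (@leq_trans #|` \bigcup_(f <- G) f|); last first.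
  by apply: card_bigfcup_le => f /greedy_sub /card2 ->.
apply: card_matching_cover => // e /sM; rewrite in_fset => es.
have e0 : e != fset0 by rewrite -cardfs_eq0 card2.
have [f fG] := greedy_maximal es e0.
apply: contraNN => /fdisjointP dis; apply/fdisjointP => x /dis.
apply: contraNN => xf; apply/bigfcupP; exists f => //; by rewrite fG.
Qed.

Definition greedy_algorithm : late_reject_algorithm.
Proof.
exists greedy_strategy => sigma k.
by rewrite accepted_greedy greedy_matching.
Defined.

(** * The adversary and the lower bound *)

Definition simple_seq (s : seq {fset nat}) : bool :=
  uniq s && all (fun e : {fset nat} => #|` e| == 2) s.

Lemma simple_seq_input (s : seq {fset nat}) :
  simple_seq s -> exists sigma : input, arrivals sigma = s.
Proof.
case/andP => us /allP cs.
have H e : e \in s -> e `<=` \bigcup_(f <- s) f /\ #|` e| = 2.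
  move=> es; split; last exact/eqP/cs.
  exact: bigfcup_sup.
by exists (Input us H).
Qed.

Lemma accepted_simple_matching (A : late_reject_algorithm) (s : seq {fset nat}) :
  simple_seq s -> matching (accepted A s).
Proof.
case/simple_seq_input => sigma <-.
by rewrite -[arrivals sigma]take_size accepted_matching.
Qed.

Lemma fresh_vertex (s : seq {fset nat}) :
  exists m, forall e x, e \in s -> x \in e -> (x < m)%N.
Proof.
exists (\max_(e <- s) \max_(x <- e) x).+1 => e x es xe; rewrite ltnS.
apply: leq_trans (leq_bigmax_seq _ es isT).
exact: (leq_bigmax_seq (F := id) x xe isT).
Qed.

(** [M] misses one of the incident edges [a] and [b], so it lies in [N] plus the other one. *)
Lemma matching_le_incident (M N : {fset {fset nat}}) (a b : {fset nat}) :
  matching M -> M `<=` b |` (a |` N) -> a != b -> ~~ [disjoint a & b]%fset ->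
  (#|` M| <= #|` N|.+1)%N.
Proof.
move=> /matchingP mM sM nab ab.
have card1 c : (#|` c |` N| <= #|` N|.+1)%N by rewrite cardfsU1; case: (_ \notin _).
have [aM|aM] := boolP (a \in M); [have [bM|bM] := boolP (b \in M)|].
- by rewrite mM in ab.
- apply: leq_trans (card1 a); apply: fsubset_leq_card; apply/fsubsetP => e eM.
  have /fset1UP [eb|//] := fsubsetP sM _ eM.
  by rewrite -eb eM in bM.
- apply: leq_trans (card1 b); apply: fsubset_leq_card; apply/fsubsetP => e eM.
  have /fset1UP [->|/fset1UP [ea|eN]] := fsubsetP sM _ eM.
  + exact: fset1U1.
  + by rewrite -ea eM in aM.
  + by rewrite in_fset1U eN orbT.
Qed.

Lemma fset2_eq (x y z t : nat) :
  ([fset x; y] == [fset z; t]) = ((x == z) && (y == t)) || ((x == t) && (y == z)).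
Proof.
apply/eqP/idP => [/fsetP H|/orP [] /andP [/eqP -> /eqP ->] //]; last exact: fsetUC.
by move: (H x) (H y) (H z) (H t); rewrite !in_fset2; lia.
Qed.

Lemma fset2_disjoint (x y z t : nat) :
  [disjoint [fset x; y] & [fset z; t]]%fset
  = [&& x != z, x != t, y != z & y != t].
Proof.
by rewrite fdisjointUX !fdisjoint1X !in_fset2 !negb_or -andbA.
Qed.

(** One round of the adversary. Carrying an explicit matching [W], rather than [OPT], makes the gain
    of two a matter of adding two fresh disjoint edges. *)
Lemma adversary_step (A : late_reject_algorithm) (s : seq {fset nat})
    (W : {fset {fset nat}}) :
  simple_seq s -> {subset W <= s} -> matching W ->
  exists t (X : {fset {fset nat}}),
    [/\ simple_seq t, {subset X <= t}, matching X, #|` X| = #|` W|.+2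
      & (#|` accepted A t| <= #|` accepted A s|.+1)%N].
Proof.
move=> ss sW mW; have [m mP] := fresh_vertex s.
(* All vertices of [s] are below [m], so each [v i j] is disjoint from every earlier edge. *)
pose v i j : {fset nat} := [fset m + i; m + j]%N.
have disj_v i j k l : [disjoint v i j & v k l]%fset
    = [&& i != k, i != l, j != k & j != l].
  by rewrite fset2_disjoint !eqn_add2l.
have eq_v i j k l : (v i j == v k l)
    = ((i == k) && (j == l)) || ((i == l) && (j == k)).
  by rewrite fset2_eq !eqn_add2l.
have vs i j e : e \in s -> [disjoint v i j & e]%fset.
  move=> es; apply/fdisjointP => x; rewrite in_fset2 => xm.
  by apply/negP => /(mP _ _ es); case/orP: xm => /eqP ->; lia.
have v_notin i j : v i j \notin s.
  by apply/negP => /(vs i j); rewrite disj_v eqxx.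
have card_v (i j : nat) : i != j -> #|` v i j| == 2
  by move=> nij; rewrite cardfs2 eqn_add2l nij.
have augment a b c d (t : seq {fset nat}) : {subset s <= t} -> v a b \in t -> v c d \in t ->
    [disjoint v a b & v c d]%fset ->
    exists X : {fset {fset nat}},
      [/\ {subset X <= t}, matching X & #|` X| = #|` W|.+2].
  move=> st abt cdt dis; exists (v a b |` (v c d |` W)); split.
  - by move=> e /fset1UP [->//|/fset1UP [->//|/sW /st]].
  - apply: matching_fsetU1; first by apply: matching_fsetU1 => // f /sW /vs.
    by move=> f /fset1UP [->//|/sW /vs].
  - have vW i j : v i j \notin W by apply: contraNN (v_notin i j) => /sW.
    rewrite !cardfsU1 in_fset1U !negb_or !vW andbT.
    suff -> : v a b != v c d by [].
    by apply: contraTneq dis => ->; rewrite disj_v eqxx.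
pose s2 := rcons (rcons s (v 1 2)) (v 2 3).
have simple_rcons u e : simple_seq u -> e \notin u -> #|` e| == 2 ->
    simple_seq (rcons u e).
  by rewrite /simple_seq rcons_uniq all_rcons => /andP [-> ->] -> ->.
have ss2 : simple_seq s2.
  apply: (simple_rcons); last exact: card_v.
    by apply: (simple_rcons); rewrite ?v_notin ?card_v.
  by rewrite mem_rcons in_cons negb_or v_notin eq_v.
have sub_rcons (t : seq {fset nat}) e : {subset s <= t} -> {subset s <= rcons t e}.
  by move=> st x /st; rewrite mem_rcons in_cons => ->; rewrite orbT.
have sub2 : {subset s <= s2} by do 2!apply: (sub_rcons).
have acc2 : accepted A s2 `<=` v 2 3 |` (v 1 2 |` accepted A s).
  exact: fsubset_trans (accepted_rcons_sub _ _ _) (fsetUS _ (accepted_rcons_sub _ _ _)).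
have new_simple i j : i != j -> v i j != v 1 2 -> v i j != v 2 3 ->
    simple_seq (rcons s2 (v i j)).
  move=> nij n1 n2; apply: (simple_rcons); rewrite ?card_v //.
  by rewrite !mem_rcons in_cons mem_rcons in_cons !negb_or n1 n2 v_notin.
have [in12|notin12] := boolP (v 1 2 \in accepted A s2).
- have st : simple_seq (rcons s2 (v 0 1)) by apply: new_simple; rewrite ?eq_v; lia.
  have [||||X [sX mX cX]] := @augment 0 1 2 3 (rcons s2 (v 0 1)).
  + exact: sub_rcons.
  + by rewrite mem_rcons mem_head.
  + by rewrite !mem_rcons in_cons mem_rcons mem_head orbT.
  + by rewrite disj_v.
  exists (rcons s2 (v 0 1)), X; split=> //.
  apply: (@matching_le_incident _ _ (v 1 2) (v 0 1)).
  + exact: accepted_simple_matching.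
  + apply: fsubset_trans (accepted_rcons_sub _ _ _) (fsetUS _ _).
    (* Holding [v 1 2] excludes the incident [v 2 3]. *)
    apply/fsubsetP => e eM; have /fset1UP [e23|//] := fsubsetP acc2 _ eM.
    have /matchingP /(_ _ _ in12 eM) := accepted_simple_matching A ss2.
    by rewrite e23 disj_v eq_v; lia.
  + by rewrite eq_v; lia.
  + by rewrite disj_v.
(* This case covers both holding [v 2 3] and holding neither edge; [v 1 2] now serves the offline
   matching only. *)
- have st : simple_seq (rcons s2 (v 3 4)) by apply: new_simple; rewrite ?eq_v; lia.
  have [||||X [sX mX cX]] := @augment 1 2 3 4 (rcons s2 (v 3 4)).
  + exact: sub_rcons.
  + by rewrite !mem_rcons in_cons mem_rcons in_cons mem_rcons mem_head !orbT.
  + by rewrite mem_rcons mem_head.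
  + by rewrite disj_v.
  exists (rcons s2 (v 3 4)), X; split=> //.
  apply: (@matching_le_incident _ _ (v 2 3) (v 3 4)).
  + exact: accepted_simple_matching.
  + apply: fsubset_trans (accepted_rcons_sub _ _ _) (fsetUS _ _).
    apply/fsubsetP => e eM.
    have /fset1UP [->|/fset1UP [e12|eN]] := fsubsetP acc2 _ eM.
    * exact: fset1U1.
    * by rewrite -e12 eM in notin12.
    * by rewrite in_fset1U eN orbT.
  + by rewrite eq_v; lia.
  + by rewrite disj_v.
Qed.

Lemma adversary (A : late_reject_algorithm) (n : nat) :
  exists sigma : input, (ALG A sigma <= n)%N /\ (2 * n <= OPT sigma)%N.
Proof.
suff [s [W [ss sW mW cW aW]]] : exists s (W : {fset {fset nat}}),
    [/\ simple_seq s, {subset W <= s}, matching W, #|` W| = (2 * n)%N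
      & (#|` accepted A s| <= n)%N].
  have [sigma def_s] := simple_seq_input ss.
  exists sigma; rewrite /ALG def_s; split=> //; rewrite -cW; apply: leq_OPT => //.
  by apply/fsubsetP => e /sW; rewrite -def_s in_fset.
elim: n => [|n [s [W [ss sW mW cW aW]]]].
  by exists [::], fset0; split=> //; apply/matchingP => e f; rewrite in_fset0.
have [t [X [st sX mX cX aX]]] := adversary_step A ss sW mW.
exists t, X; split=> //; first by rewrite cX cW; lia.
exact: leq_trans aX _.
Qed.

Local Open Scope ring_scope.

Theorem theorem7 (R : realType) :
  (exists A : late_reject_algorithm, strictly_competitive A (2 : R)) /\
  (forall c : R, c < 2 ->
     forall A : late_reject_algorithm, ~ competitive A c).
Proof.
split.
  exists greedy_algorithm => sigma; rewrite addr0 -natrM ler_nat /ALG.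
  by rewrite accepted_greedy OPT_le_greedy.
move=> c c2 A [alpha comp].
(* Replacing [c] by a nonnegative factor below 2 lets [ALG A sigma <= n] be multiplied by it. *)
pose c' := Num.max c 0.
have c'2 : c' < 2 by rewrite gt_max c2 ltr0n.
have c'0 : 0 <= c' by rewrite le_max lexx orbT.
have cc' : c <= c' by rewrite le_max lexx.
(* Enough rounds that the gap [n * (2 - c')] exceeds [alpha]; then
   [2 * n <= OPT <= c' * n + alpha < 2 * n], a contradiction. *)
pose n := Num.bound (`|alpha| / (2 - c')).
have [sigma [algn optn]] := adversary A n.
have := comp sigma.
have alpha_n : `|alpha| < n%:R * (2 - c').
  by rewrite -ltr_pdivrMr ?subr_gt0 // archi_boundP // divr_ge0 // subr_ge0 ltW.
have := ler_norm alpha.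
have : 2 * n%:R <= (OPT sigma)%:R :> R by rewrite -natrM ler_nat.
have : c * (ALG A sigma)%:R <= c' * n%:R.
  apply: (@le_trans _ _ (c' * (ALG A sigma)%:R)); first exact: ler_wpM2r.
  by apply: ler_wpM2l; rewrite ?ler_nat.
lra.
Qed.
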